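(* Let $\mathbf{k}$ be a commutative unitary ring and let $(A,\ast)$ be a $\mathbf{k}$-algebra. (a) Let $(R,\circ,\ell,r)$ be an $A$-bimodule $\mathbf{k}$-algebra, let $\lambda\in\mathbf{k}$, and let $\alpha:R\to A$ be an $\mathcal{O}$-operator on the algebra $R$ of weight $\lambda$. If $\ker\alpha$ is an ideal of $(R,\circ)$, then there is a dendriform trialgebra structure on $\alpha(R)$ given by $$\alpha(u)\prec_{\alpha,A}\alpha(v):=\alpha(u\,r(\alpha(v))),\quad \alpha(u)\succ_{\alpha,A}\alpha(v):=\alpha(\ell(\alpha(u))v),\quad \alpha(u)\cdot_{\alpha,A}\alpha(v):=\alpha(\lambda\,u\circ v),\quad\forall u,v\in R.$$ Furthermore, $\ast=\prec_{\alpha,A}+\succ_{\alpha,A}+\cdot_{\alpha,A}$ on $\alpha(R)$. In particular, if the $\mathcal{O}$-operator $\alpha$ is invertible (that is, bijective as a $\mathbf{k}$-linear map), then the multiplications $$x\prec_{\alpha,A}y:=\alpha(\alpha^{-1}(x)\,r(y)),\quad x\succ_{\alpha,A}y:=\alpha(\ell(x)\alpha^{-1}(y)),\quad x\cdot_{\alpha,A}y:=\alpha(\lambda\,\alpha^{-1}(x)\circ\alpha^{-1}(y)),\quad\forall x,y\in A,$$ define a dendriform trialgebra $(A,\prec_{\alpha,A},\succ_{\alpha,A},\cdot_{\alpha,A})$ such that $\ast=\prec_{\alpha,A}+\succ_{\alpha,A}+\cdot_{\alpha,A}$ on $A$. (b) Let $(V,\ell,r)$ be an $A$-bimodule and let $\alpha:V\to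 A$ be an invertible $\mathcal{O}$-operator on the module $V$. Then $$x\prec_{\alpha,A}y:=\alpha(\alpha^{-1}(x)\,r(y)),\quad x\succ_{\alpha,A}y:=\alpha(\ell(x)\alpha^{-1}(y)),\quad\forall x,y\in A,$$ define a dendriform dialgebra $(A,\prec_{\alpha,A},\succ_{\alpha,A})$ on $A$ such that $\ast=\prec_{\alpha,A}+\succ_{\alpha,A}$ on $A$.
   Context: A $\mathbf{k}$-algebra means an associative, not necessarily unitary, $\mathbf{k}$-algebra. Bimodules. For a $\mathbf{k}$-algebra $(A,\ast)$, an $A$-bimodule $(V,\ell,r)$ is a $\mathbf{k}$-module $V$ with $\mathbf{k}$-linear maps $\ell,r:A\to\mathrm{End}_{\mathbf{k}}(V)$, where $r(x)$ is written on the right of its argument ($v\,r(x)$ denotes $r(x)$ applied to $v$), such that for all $x,y\in A$, $v\in V$: $\ell(x\ast y)v=\ell(x)(\ell(y)v)$, $v\,r(x\ast y)=(v\,r(x))\,r(y)$, $(\ell(x)v)\,r(y)=\ell(x)(v\,r(y))$. No unit condition is imposed. An $A$-bimodule $\mathbf{k}$-algebra $(R,\circ,\ell,r)$ is a $\mathbf{k}$-algebra $(R,\circ)$ together with an $A$-bimodule structure $(R,\ell,r)$ such that for all $x\in A$, $v,w\in R$: $\ell(x)(v\circ w)=(\ell(x)v)\circ w$, $(v\circ w)\,r(x)=v\circ(w\,r(x))$, $(v\,r(x))\circ w=v\circ(\ell(x)w)$. $\mathcal{O}$-operators. Given an $A$-bimodule $(V,\ell,r)$, a $\mathbf{k}$-linear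 map $\alpha:V\to A$ is an $\mathcal{O}$-operator on the module $V$ if $\alpha(u)\ast\alpha(v)=\alpha(\ell(\alpha(u))v)+\alpha(u\,r(\alpha(v)))$ for all $u,v\in V$. Given an $A$-bimodule $\mathbf{k}$-algebra $(R,\circ,\ell,r)$ and $\lambda\in\mathbf{k}$, a $\mathbf{k}$-linear map $\alpha:R\to A$ is an $\mathcal{O}$-operator on the algebra $R$ of weight $\lambda$ if $\alpha(u)\ast\alpha(v)=\alpha(\ell(\alpha(u))v)+\alpha(u\,r(\alpha(v)))+\lambda\,\alpha(u\circ v)$ for all $u,v\in R$. A dendriform dialgebra is a $\mathbf{k}$-module $D$ with bilinear operations $\prec,\succ$ such that, with $x\star y=x\prec y+x\succ y$, for all $x,y,z\in D$: $(x\prec y)\prec z=x\prec(y\star z)$, $(x\succ y)\prec z=x\succ(y\prec z)$, $x\succ(y\succ z)=(x\star y)\succ z$. A dendriform trialgebra is a $\mathbf{k}$-module $T$ with bilinear operations $\prec,\succ,\cdot$ such that, with $x\star y=x\prec y+x\succ y+x\cdot y$, for all $x,y,z\in T$: $(x\prec y)\prec z=x\prec(y\star z)$, $(x\succ y)\prec z=x\succ(y\prec z)$, $(x\star y)\succ z=x\succ(y\succ z)$, $(x\succ y)\cdot z=x\succ(y\cdot z)$, $(x\prec y)\cdot z=x\cdot(y\succ z)$, $(x\cdot y)\prec z=x\cdot(y\prec z)$, $(x\cdot y)\cdot z=x\cdot(y\cdot z)$. The assertion in (a) that the operations on $\alpha(R)$ are ''given by'' the displayed formulas includes that they are well defined,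 i.e. independent of the choice of preimages $u,v$. *)

(* Defs.v *)
From HB Require Import structures.
From mathcomp Require Import all_boot all_order all_algebra.
From mathcomp Require Import boolp classical_sets.

Set Implicit Arguments.
Unset Strict Implicit.
Unset Printing Implicit Defensive.

Import GRing.Theory.
Local Open Scope classical_set_scope.
Local Open Scope ring_scope.

(* Same content as [bilinear_for *:%R *:%R f] of sesquilinear.v, which is only
   available over a nontrivial ring; here the zero ring is allowed. *)
Definition is_bilinear (k : pzRingType) (U V W : lmodType k)
    (f : U -> V -> W) : Prop :=
  (forall v : V, linear (fun u : U => f u v)) /\
  (forall u : U, linear (f u)).

(* Associative, not necessarily unital k-algebra (mathcomp's algebras are
   unital, so the product is an explicit operation on a k-module). *)
Record is_algebra (k : comPzRingType) (A : lmodType k)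
    (mul : A -> A -> A) : Prop := IsAlgebra {
  algebra_bilinear : is_bilinear mul;
  algebra_assoc : associative mul
}.

(* [l x v] is l(x)v and [r x v] is v r(x): although the acting element comes
   first in [r x v], r is a right action.  Linearity of l, r : A -> End_k(V),
   including that each l(x), r(x) is k-linear, is bilinearity of l and r. *)
Record is_bimodule (k : comPzRingType) (A : lmodType k) (mul : A -> A -> A)
    (V : lmodType k) (l r : A -> V -> V) : Prop := IsBimodule {
  bimod_l_bilinear : is_bilinear l;
  bimod_r_bilinear : is_bilinear r;
  bimod_lM : forall (x y : A) (v : V), l (mul x y) v = l x (l y v);
  bimod_rM : forall (x y : A) (v : V), r (mul x y) v = r y (r x v);
  bimod_lr : forall (x y : A) (v : V), r y (l x v) = l x (r y v)
}.

Record is_bimodule_algebra (k : comPzRingType) (A : lmodType k)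
    (mul : A -> A -> A) (R : lmodType k) (circ : R -> R -> R)
    (l r : A -> R -> R) : Prop := IsBimoduleAlgebra {
  bimod_alg_algebra : is_algebra circ;
  bimod_alg_bimodule : is_bimodule mul l r;
  bimod_alg_l : forall (x : A) (v w : R), l x (circ v w) = circ (l x v) w;
  bimod_alg_r : forall (x : A) (v w : R), r x (circ v w) = circ v (r x w);
  bimod_alg_rl : forall (x : A) (v w : R), circ (r x v) w = circ v (l x w)
}.

Definition is_O_operator_module (k : comPzRingType) (A : lmodType k)
    (mul : A -> A -> A) (V : lmodType k) (l r : A -> V -> V)
    (alpha : {linear V -> A}) : Prop :=
  forall u v : V,
    mul (alpha u) (alpha v) =
      alpha (l (alpha u) v) + alpha (r (alpha v) u).

Definition is_O_operator_algebra (k : comPzRingType) (A : lmodType k)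
    (mul : A -> A -> A) (R : lmodType k) (circ : R -> R -> R)
    (l r : A -> R -> R) (lambda : k) (alpha : {linear R -> A}) : Prop :=
  forall u v : R,
    mul (alpha u) (alpha v) =
      alpha (l (alpha u) v) + alpha (r (alpha v) u)
      + lambda *: alpha (circ u v).

Record is_dendriform_dialgebra (k : comPzRingType) (D : lmodType k)
    (prec succ : D -> D -> D) : Prop := IsDendriformDialgebra {
  dendri_prec_bilinear : is_bilinear prec;
  dendri_succ_bilinear : is_bilinear succ;
  dendri_prec_prec : forall x y z : D,
    prec (prec x y) z = prec x (prec y z + succ y z);
  dendri_succ_prec : forall x y z : D,
    prec (succ x y) z = succ x (prec y z);
  dendri_succ_succ : forall x y z : D,
    succ x (succ y z) = succ (prec x y + succ x y) z
}.

Record is_dendriform_trialgebra (k : comPzRingType) (T : lmodType k)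
    (prec succ dot : T -> T -> T) : Prop := IsDendriformTrialgebra {
  tri_prec_bilinear : is_bilinear prec;
  tri_succ_bilinear : is_bilinear succ;
  tri_dot_bilinear : is_bilinear dot;
  tri_prec_prec : forall x y z : T,
    prec (prec x y) z = prec x (prec y z + succ y z + dot y z);
  tri_succ_prec : forall x y z : T,
    prec (succ x y) z = succ x (prec y z);
  tri_star_succ : forall x y z : T,
    succ (prec x y + succ x y + dot x y) z = succ x (succ y z);
  tri_succ_dot : forall x y z : T,
    dot (succ x y) z = succ x (dot y z);
  tri_prec_dot : forall x y z : T,
    dot (prec x y) z = dot x (succ y z);
  tri_dot_prec : forall x y z : T,
    prec (dot x y) z = dot x (prec y z);
  tri_dot_dot : forall x y z : T,
    dot (dot x y) z = dot x (dot y z)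
}.

Definition lin_ker (k : pzRingType) (R A : lmodType k) (alpha : {linear R -> A}) :
    set R :=
  [set u | alpha u = 0].

Record is_ideal (k : comPzRingType) (R : lmodType k) (circ : R -> R -> R)
    (I : set R) : Prop := IsIdeal {
  ideal0 : I 0;
  ideal_linear : forall (a : k) (u v : R), I u -> I v -> I (a *: u + v);
  ideal_mull : forall u v : R, I v -> I (circ u v);
  ideal_mulr : forall u v : R, I u -> I (circ u v)
}.

(* The k-submodule alpha(R) of A, as a k-module in its own right.  Subtypes need
   a boolean predicate, hence the classical [`[< _ >]]. *)
Section ImageModule.
Variables (k : pzRingType) (R A : lmodType k) (alpha : {linear R -> A}).

Definition in_lin_image : {pred A} := fun x => `[< exists u : R, alpha u = x >].

Lemma in_lin_imageP (x : A) : reflect (exists u, alpha u = x) (x \in in_lin_image).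
Proof. exact: asboolP. Qed.

Lemma in_lin_image_submod_closed : submod_closed in_lin_image.
Proof.
split=> [|a x y /in_lin_imageP[u <-] /in_lin_imageP[v <-]]; apply/in_lin_imageP.
  by exists 0; rewrite linear0.
by exists (a *: u + v); rewrite linearP.
Qed.

HB.instance Definition _ :=
  GRing.isSubmodClosed.Build k A in_lin_image in_lin_image_submod_closed.

Definition lin_image : Type := {x : A | x \in in_lin_image}.

HB.instance Definition _ := SubChoice.on lin_image.
HB.instance Definition _ := [SubChoice_isSubLmodule of lin_image by <:].

Lemma mem_lin_image (u : R) : alpha u \in in_lin_image.
Proof. by apply/in_lin_imageP; exists u. Qed.

Definition to_lin_image (u : R) : lin_image := exist _ (alpha u) (mem_lin_image u).

End ImageModule.

(* Main.v *)
Require Import Defs.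
From HB Require Import structures.
From mathcomp Require Import all_boot all_algebra.
From mathcomp Require Import boolp.

(** The formulas say that the three operations on the image of [alpha] are the
    two actions and the product [lambda *: circ] of [R], pushed forward along
    [alpha].  Among the dendriform trialgebra axioms, five (those in which the
    sum [prec + succ + dot] does not occur) are then images of identities of
    [R]: the actions commute, each of them is compatible with [circ], and [circ]
    is associative.  The other two contain the sum, and they are images of the
    module axioms [bimod_rM] and [bimod_lM], once that sum is known to be the
    product of [A]; this is precisely the equation defining an O-operator.

    The image module and the invertible case are treated together in
    [pushforward_trialgebra]: [alpha] is factored as a surjection [p : R -> T]
    followed by a linear map [i : T -> A].  On the image, what remains is that
    the operations are well defined.  If [alpha v = 0], the O-operator equation
    for [(u, v)] reduces to [alpha (l (alpha u) v) + lambda *: alpha (circ u v)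
    = 0], and the second term vanishes because the kernel is an ideal; the same
    argument works for [r] ([O_operator_ker]).

    A bimodule is a bimodule algebra for the zero product, and a trialgebra with
    zero [dot] is a dialgebra, which turns the statement on modules into a
    special case of the one on algebras. *)

Set Implicit Arguments.
Unset Strict Implicit.
Unset Printing Implicit Defensive.

Import GRing.Theory.
Local Open Scope ring_scope.

Lemma linear_fun0 (k : pzRingType) (U V : lmodType k) (f : U -> V) :
  linear f -> f 0 = 0.
Proof.
by move=> fD; have := fD (-1) 0 0; rewrite scaler0 addr0 scaleN1r addNr.
Qed.

Lemma linear_funZ (k : pzRingType) (U V : lmodType k) (f : U -> V) :
  linear f -> forall a u, f (a *: u) = a *: f u.
Proof.
by move=> fD a u; have := fD a u 0; rewrite (linear_fun0 fD) !addr0.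
Qed.

Lemma is_bilinear0 (k : pzRingType) (U V W : lmodType k) :
  is_bilinear (fun (_ : U) (_ : V) => 0 : W).
Proof. by split=> ? ? ? ?; rewrite scaler0 addr0. Qed.

Lemma to_lin_image_is_linear (k : pzRingType) (R A : lmodType k)
    (alpha : {linear R -> A}) : linear (to_lin_image alpha).
Proof. by move=> a u v; apply: val_inj; rewrite [RHS]linearP /= linearP. Qed.

HB.instance Definition _ (k : pzRingType) (R A : lmodType k)
    (alpha : {linear R -> A}) :=
  GRing.isLinear.Build k R (lin_image alpha) *:%R (to_lin_image alpha)
    (to_lin_image_is_linear alpha).

(** The chosen lift of [x] may fail to depend linearly on [x]; operations defined
    through [s] become bilinear only once independence of the lift is known. *)
Lemma to_lin_image_section (k : pzRingType) (R A : lmodType k)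
    (alpha : {linear R -> A}) :
  exists s : lin_image alpha -> R, cancel s (to_lin_image alpha).
Proof.
have /choice[s sK] (x : lin_image alpha) : exists u, to_lin_image alpha u = x.
  by have /in_lin_imageP[u ux] := valP x; exists u; apply: val_inj.
by exists s.
Qed.

(** Every element of [T] lifts along [p], so each axiom can be checked on
    elements of [R], where it is an axiom of bimodule algebras.  The last
    hypothesis makes the sum of the three operations act on [R] as a product in
    [A].  The map [i] is meant to be the inclusion of the image, or the identity
    of [A] if [alpha] is bijective. *)
Lemma pushforward_trialgebra (k : comPzRingType) (A R T : lmodType k)
    (mul : A -> A -> A) (circ : R -> R -> R) (l r : A -> R -> R) (lambda : k)
    (p : {linear R -> T}) (s : T -> R) (i : {linear T -> A})
    (prec succ dot : T -> T -> T) :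
  is_bimodule_algebra mul circ l r ->
  cancel s p ->
  (forall u y, prec (p u) y = p (r (i y) u)) ->
  (forall x v, succ x (p v) = p (l (i x) v)) ->
  (forall u v, dot (p u) (p v) = p (lambda *: circ u v)) ->
  (forall x y, mul (i x) (i y) = i (prec x y + succ x y + dot x y)) ->
  is_dendriform_trialgebra prec succ dot.
Proof.
move=> [[[circDl circDr] circA] bimod circ_l circ_r circ_rl] sK precE succE dotE.
case: bimod => [[lDl lDr] [rDl rDr] lM rM lr] star.
split.
- split=> [y a x x' | x a y y'] /=.
    by rewrite -(sK x) -(sK x') -linearP !precE rDr linearP.
  by rewrite -(sK x) !precE linearP rDl linearP.
- split=> [y a x x' | x a y y'] /=.
    by rewrite -(sK y) !succE linearP lDl linearP.
  by rewrite -(sK y) -(sK y') -linearP !succE lDr linearP.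
- split=> [y a x x' | x a y y'] /=.
    rewrite -(sK x) -(sK x') -(sK y) -linearP !dotE circDl -linearP.
    by rewrite scalerDr !scalerA mulrC.
  rewrite -(sK x) -(sK y') -(sK y) -linearP !dotE circDr -linearP.
  by rewrite scalerDr !scalerA mulrC.
- by move=> x y z; rewrite -(sK x) !precE -star rM.
- by move=> x y z; rewrite -(sK y) succE !precE succE lr.
- by move=> x y z; rewrite -(sK z) !succE -star lM.
- move=> x y z; rewrite -(sK y) -(sK z) succE !dotE succE.
  by rewrite (linear_funZ (lDr _)) circ_l.
- by move=> x y z; rewrite -(sK x) -(sK y) -(sK z) precE succE !dotE circ_rl sK.
- move=> x y z; rewrite -(sK x) -(sK y) dotE !precE dotE.
  by rewrite (linear_funZ (rDr _)) circ_r.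
- move=> x y z; rewrite -(sK x) -(sK y) -(sK z) !dotE.
  by rewrite (linear_funZ (circDl _)) (linear_funZ (circDr _)) circA.
Qed.

(** The O-operator equation makes the kernel stable under the actions of the
    image; this is where the ideal hypothesis enters. *)
Lemma O_operator_ker (k : comPzRingType) (A R : lmodType k)
    (mul : A -> A -> A) (circ : R -> R -> R) (l r : A -> R -> R) (lambda : k)
    (alpha : {linear R -> A}) :
  is_bilinear mul -> is_bilinear l -> is_bilinear r ->
  is_O_operator_algebra mul circ l r lambda alpha ->
  is_ideal circ (lin_ker alpha) ->
  forall u v, alpha v = 0 ->
    alpha (l (alpha u) v) = 0 /\ alpha (r (alpha u) v) = 0.
Proof.
move=> [mulDl mulDr] [lDl _] [rDl _] alphaO [_ _ ker_l ker_r] u v v0.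
split.
  have := alphaO u v; rewrite v0 (linear_fun0 (mulDr _)) (linear_fun0 (rDl u)).
  by rewrite (ker_l u v v0) linear0 scaler0 !addr0.
have := alphaO v u; rewrite v0 (linear_fun0 (mulDl _)) (linear_fun0 (lDl u)).
by rewrite (ker_r v u v0) linear0 scaler0 addr0 add0r.
Qed.

(** Turns independence of preimages into a statement about the kernel. *)
Lemma eq_linear_ker (k : pzRingType) (U V W : lmodType k)
    (alpha : {linear U -> V}) (f : U -> W) :
  linear f -> (forall u, alpha u = 0 -> f u = 0) ->
  forall u v, alpha u = alpha v -> f u = f v.
Proof.
move=> fD f0 u v uv.
have := fD (-1) v u; rewrite f0; last by rewrite linearP uv scaleN1r addNr.
by rewrite scaleN1r addrC => /esym/subr0_eq.
Qed.

(** The operations are defined through arbitrary lifts; [O_operator_ker], for the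
    two actions, and the ideal property, for [circ], show that the lift does not
    matter, and [pushforward_trialgebra] applies with [i] the inclusion. *)
Lemma O_operator_image_trialgebra (k : comPzRingType) (A R : lmodType k)
    (mul : A -> A -> A) (circ : R -> R -> R) (l r : A -> R -> R) (lambda : k)
    (alpha : {linear R -> A}) :
  is_bilinear mul ->
  is_bimodule_algebra mul circ l r ->
  is_O_operator_algebra mul circ l r lambda alpha ->
  is_ideal circ (lin_ker alpha) ->
  exists prec succ dot : lin_image alpha -> lin_image alpha -> lin_image alpha,
    [/\ is_dendriform_trialgebra prec succ dot,
        (forall u v : R,
          [/\ prec (to_lin_image alpha u) (to_lin_image alpha v) =
                to_lin_image alpha (r (alpha v) u),
              succ (to_lin_image alpha u) (to_lin_image alpha v) =
                to_lin_image alpha (l (alpha u) v)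
            & dot (to_lin_image alpha u) (to_lin_image alpha v) =
                to_lin_image alpha (lambda *: circ u v)])
      & forall x y : lin_image alpha,
          mul (val x) (val y) = val (prec x y + succ x y + dot x y)].
Proof.
move=> mulD Ralg alphaO kerI.
have [[[circDl circDr] _] [lD rD _ _ _] _ _ _] := Ralg.
have [s sK] := to_lin_image_section alpha.
have stable := O_operator_ker mulD lD rD alphaO kerI.
have [_ _ ker_l ker_r] := kerI.
pose p := to_lin_image alpha.
have alpha_s u : alpha (s (p u)) = alpha u by exact: (congr1 val (sK (p u))).
pose prec (x y : lin_image alpha) := p (r (val y) (s x)).
pose succ (x y : lin_image alpha) := p (l (val x) (s y)).
pose dot x y := p (lambda *: circ (s x) (s y)).
have precE u y : prec (p u) y = p (r (val y) u).
  apply: val_inj => /=; move: (alpha_s u).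
  apply: (@eq_linear_ker _ _ _ _ alpha (fun u => alpha (r (val y) u))).
    by move=> a v w; rewrite rD.2 linearP.
  by move=> v v0; rewrite -(sK y); apply: (stable _ _ v0).2.
have succE x v : succ x (p v) = p (l (val x) v).
  apply: val_inj => /=; move: (alpha_s v).
  apply: (@eq_linear_ker _ _ _ _ alpha (fun u => alpha (l (val x) u))).
    by move=> a u w; rewrite lD.2 linearP.
  by move=> u u0; rewrite -(sK x); apply: (stable _ _ u0).1.
have dotE u v : dot (p u) (p v) = p (lambda *: circ u v).
  apply: val_inj; rewrite /= !linearZ /=; congr (_ *: _).
  transitivity (alpha (circ u (s (p v)))); [move: (alpha_s u) | move: (alpha_s v)].
    apply: (@eq_linear_ker _ _ _ _ alpha (fun w => alpha (circ w (s (p v))))).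
      by move=> a w w'; rewrite circDl linearP.
    by move=> w; apply: ker_r.
  apply: (@eq_linear_ker _ _ _ _ alpha (fun w => alpha (circ u w))).
    by move=> a w w'; rewrite circDr linearP.
  by move=> w; apply: ker_l.
have star x y : mul (val x) (val y) = val (prec x y + succ x y + dot x y).
  rewrite -(sK x) -(sK y) precE succE dotE /= alphaO linearZ /=.
  by rewrite [X in X + _]addrC.
exists prec, succ, dot; split=> [|u v|//]; last by rewrite precE succE dotE.
exact: (pushforward_trialgebra (p := p) (i := val) Ralg sK precE succE dotE star).
Qed.

(** The case [p = alpha], [i = id] of [pushforward_trialgebra]; the operations
    are well defined because preimages are unique. *)
Lemma O_operator_inv_trialgebra (k : comPzRingType) (A R : lmodType k)
    (mul : A -> A -> A) (circ : R -> R -> R) (l r : A -> R -> R) (lambda : k)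
    (alpha : {linear R -> A}) (alpha_inv : A -> R) :
  is_bimodule_algebra mul circ l r ->
  is_O_operator_algebra mul circ l r lambda alpha ->
  cancel alpha alpha_inv -> cancel alpha_inv alpha ->
  let prec := fun x y : A => alpha (r y (alpha_inv x)) in
  let succ := fun x y : A => alpha (l x (alpha_inv y)) in
  let dot := fun x y : A =>
    alpha (lambda *: circ (alpha_inv x) (alpha_inv y)) in
  is_dendriform_trialgebra prec succ dot /\
  (forall x y : A, mul x y = prec x y + succ x y + dot x y).
Proof.
move=> Ralg alphaO alphaK alphaVK prec succ dot.
have star x y : mul x y = prec x y + succ x y + dot x y.
  rewrite -{1}(alphaVK x) -{1}(alphaVK y) alphaO !alphaVK /dot linearZ /=.
  by rewrite [X in X + _]addrC.
split=> //; apply: (pushforward_trialgebra (p := alpha) (i := idfun) Ralg alphaVK).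
- by move=> u y; rewrite /prec alphaK.
- by move=> x v; rewrite /succ alphaK.
- by move=> u v; rewrite /dot !alphaK.
- exact: star.
Qed.

Lemma is_bimodule_algebra0 (k : comPzRingType) (A V : lmodType k)
    (mul : A -> A -> A) (l r : A -> V -> V) :
  is_bimodule mul l r -> is_bimodule_algebra mul (fun _ _ => 0) l r.
Proof.
move=> Vbimod; have [[_ lD] [_ rD] _ _ _] := Vbimod.
split=> // [|x _ _|x _ _].
- by split; first exact: is_bilinear0.
- by rewrite (linear_fun0 (lD x)).
- by rewrite (linear_fun0 (rD x)).
Qed.

Lemma dialgebra_of_trialgebra0 (k : comPzRingType) (D : lmodType k)
    (prec succ dot : D -> D -> D) :
  (forall x y, dot x y = 0) ->
  is_dendriform_trialgebra prec succ dot -> is_dendriform_dialgebra prec succ.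
Proof.
move=> dot0 [precD succD _ prec_prec succ_prec star_succ _ _ _ _].
split=> // x y z; first by rewrite prec_prec dot0 addr0.
by rewrite -star_succ dot0 addr0.
Qed.

Theorem proposition3p1 (k : comPzRingType) (A : lmodType k)
    (mul : A -> A -> A) (mul_alg : is_algebra mul) :
  (* (a) *)
  (forall (R : lmodType k) (circ : R -> R -> R) (l r : A -> R -> R)
      (lambda : k) (alpha : {linear R -> A}),
    is_bimodule_algebra mul circ l r ->
    is_O_operator_algebra mul circ l r lambda alpha ->
    (is_ideal circ (lin_ker alpha) ->
      exists prec succ dot : lin_image alpha -> lin_image alpha -> lin_image alpha,
        [/\ is_dendriform_trialgebra prec succ dot,
            (forall u v : R,
              [/\ prec (to_lin_image alpha u) (to_lin_image alpha v) =
                    to_lin_image alpha (r (alpha v) u),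
                  succ (to_lin_image alpha u) (to_lin_image alpha v) =
                    to_lin_image alpha (l (alpha u) v)
                & dot (to_lin_image alpha u) (to_lin_image alpha v) =
                    to_lin_image alpha (lambda *: circ u v)])
          & forall x y : lin_image alpha,
              mul (val x) (val y) = val (prec x y + succ x y + dot x y)]) /\
    (forall alpha_inv : A -> R,
      cancel alpha alpha_inv -> cancel alpha_inv alpha ->
      let prec := fun x y : A => alpha (r y (alpha_inv x)) in
      let succ := fun x y : A => alpha (l x (alpha_inv y)) in
      let dot := fun x y : A =>
        alpha (lambda *: circ (alpha_inv x) (alpha_inv y)) in
      is_dendriform_trialgebra prec succ dot /\
      (forall x y : A, mul x y = prec x y + succ x y + dot x y))) /\
  (* (b) *)
  (forall (V : lmodType k) (l r : A -> V -> V) (alpha : {linear V -> A}),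
    is_bimodule mul l r ->
    is_O_operator_module mul l r alpha ->
    forall alpha_inv : A -> V,
      cancel alpha alpha_inv -> cancel alpha_inv alpha ->
      let prec := fun x y : A => alpha (r y (alpha_inv x)) in
      let succ := fun x y : A => alpha (l x (alpha_inv y)) in
      is_dendriform_dialgebra prec succ /\
      (forall x y : A, mul x y = prec x y + succ x y)).
Proof.
split=> [R circ l r lambda alpha Ralg alphaO | V l r alpha Vbimod alphaO alpha_inv].
  split=> [kerI | alpha_inv]; last exact: O_operator_inv_trialgebra.
  exact: O_operator_image_trialgebra (algebra_bilinear mul_alg) Ralg alphaO kerI.
move=> alphaK alphaVK prec succ.
have alphaO0 : is_O_operator_algebra mul (fun _ _ => 0) l r 0 alpha.
  by move=> u v; rewrite scale0r addr0.
have [tri star] :=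
  O_operator_inv_trialgebra (is_bimodule_algebra0 Vbimod) alphaO0 alphaK alphaVK.
split=> [|x y]; last by rewrite star scaler0 linear0 addr0.
by apply: dialgebra_of_trialgebra0 tri => x y; rewrite scaler0 linear0.
Qed.
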